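(* Let $K$ be a field, let $S=K[x_1,\ldots,x_n,y_1,\ldots,y_m]$, and let $1\leq q\leq n$, $1\leq r\leq m$. Then for every $i\geq 0$, $$\beta_i(I_qJ_r)=\beta_{i,q+r+i}(I_qJ_r)=\sum_{j+k=i}\binom{n}{q+j}\binom{m}{r+k}\binom{q+j-1}{j}\binom{r+k-1}{k},$$ where the sum is over all pairs of integers $j,k\geq 0$ with $j+k=i$.
   Context: $I_l$ (resp. $J_p$) denotes the ideal of $S=K[x_1,\ldots,x_n,y_1,\ldots,y_m]$ generated by all square-free monomials of degree $l$ in the variables $x_1,\ldots,x_n$ (resp. of degree $p$ in the variables $y_1,\ldots,y_m$). $S$ carries the standard grading. For a graded ideal $I\subset S$ with minimal graded free resolution $0\to F_p\to\cdots\to F_1\to F_0\to I\to 0$ over $S$, write $F_i=\bigoplus_j S(-j)^{\beta_{i,j}(I)}$; the $\beta_{i,j}(I)$ are the graded Betti numbers and $\beta_i(I)=\sum_j\beta_{i,j}(I)$ is the rank of $F_i$. Note that the resolution is of the ideal $I$ itself, not of $S/I$. Binomial coefficients $\binom{a}{b}$ with $0\le a<b$ are $0$. *)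

(* Defs.v *)
From Stdlib Require Import ClassicalEpsilon.
From mathcomp Require Import all_boot all_order all_algebra.
From mathcomp Require Import mpoly.

Set Implicit Arguments.
Unset Strict Implicit.
Unset Printing Implicit Defensive.

Import GRing.Theory.
Local Open Scope ring_scope.

Section Ideals.
Variables (K : fieldType) (N : nat).
Local Notation S := {mpoly K[N]}.

Definition ideal_span (G : S -> Prop) : S -> Prop := fun p =>
  exists (k : nat) (a g : 'I_k -> S),
    (forall i, G (g i)) /\ p = \sum_(i < k) a i * g i.

Definition ideal_mul (I J : S -> Prop) : S -> Prop :=
  ideal_span (fun p => exists f g, [/\ I f, J g & p = f * g]).

Definition irrelevant_ideal : S -> Prop :=
  ideal_span (fun p => exists i : 'I_N, p = 'X_i).

End Ideals.

(* The variables of K[x_1..x_n, y_1..y_m] are those of {mpoly K[n + m]}: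
   x_i is 'X_(lshift m i) and y_j is 'X_(rshift n j). *)
Definition sqfree_x (K : fieldType) (n m l : nat) : {mpoly K[n + m]} -> Prop :=
  ideal_span (fun p => exists A : {set 'I_n},
    #|A| = l /\ p = \prod_(i in A) 'X_(lshift m i)).

Definition sqfree_y (K : fieldType) (n m p : nat) : {mpoly K[n + m]} -> Prop :=
  ideal_span (fun f => exists B : {set 'I_m},
    #|B| = p /\ f = \prod_(j in B) 'X_(rshift n j)).

Section Resolutions.
Variables (K : fieldType) (N : nat).
Local Notation S := {mpoly K[N]}.

(* F_i = \bigoplus_a S(- frshift i a), a < frrank i, as row vectors; maps act by
   right multiplication: v |-> v *m frdiff i is F_(i+1) -> F_i, and
   v |-> v *m fraug is the augmentation F_0 -> S. *)
Record free_complex := FreeComplex {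
  frrank : nat -> nat;
  frshift : forall i, 'I_(frrank i) -> nat;
  frdiff : forall i, 'M[S]_(frrank i.+1, frrank i);
  fraug : 'cV[S]_(frrank 0) }.

(* 1 |-> p is a degree-0 map S(-a) -> S(-b), i.e. p lies in S_(a-b),
   which is zero for a < b. *)
Definition degree0_entry (a b : nat) (p : S) : bool :=
  if (b <= a)%N then p \is (a - b)%N.-homog else p == 0.

Definition graded_complex (F : free_complex) : Prop :=
  (forall i a b, degree0_entry (@frshift F i.+1 a) (@frshift F i b)
                               (frdiff F i a b)) /\
  (forall a, degree0_entry (@frshift F 0 a) 0 (fraug F a 0)).

Definition resolves (F : free_complex) (I : S -> Prop) : Prop :=
  [/\ forall p, I p <-> exists v : 'rV_(frrank F 0), v *m fraug F = p%:M,
      forall v : 'rV_(frrank F 0),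
        v *m fraug F = 0 <-> exists w, v = w *m frdiff F 0,
      forall i (v : 'rV_(frrank F i.+1)),
        v *m frdiff F i = 0 <-> exists w, v = w *m frdiff F i.+1
    & exists l, forall i, (l < i)%N -> frrank F i = 0%N].

Definition minimal_complex (F : free_complex) : Prop :=
  forall i a b, irrelevant_ideal (frdiff F i a b).

Definition min_graded_free_resolution (I : S -> Prop) (F : free_complex) :=
  [/\ graded_complex F, resolves F I & minimal_complex F].

Definition zero_complex : free_complex :=
  @FreeComplex (fun=> 0%N) (fun _ _ => 0%N) (fun=> 0) 0.

(* A choice of minimal graded free resolution; it is unique up to isomorphism,
   and it exists for every graded ideal. *)
Definition min_res (I : S -> Prop) : free_complex :=
  epsilon (inhabits zero_complex) (min_graded_free_resolution I).

Definition graded_betti (I : S -> Prop) (i j : nat) : nat :=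
  #|[set a | @frshift (min_res I) i a == j]|.

Definition betti (I : S -> Prop) (i : nat) : nat := frrank (min_res I) i.

End Resolutions.

(* Main.v *)
From Stdlib Require Import ClassicalEpsilon FunctionalExtensionality.
Require Import Defs.
From mathcomp Require Import all_boot all_order all_algebra.
From mathcomp Require Import mpoly.

(** The ideal I_q J_r is generated by the square-free monomials x_C, where C runs
    over the sets of variables with q elements among the x's and r among the y's.
    Taken in colexicographic order these generators have linear quotients: the
    ideal of the earlier generators has, as its colon by x_C, the ideal generated
    by a set T(C) of variables, namely the z not in C that are smaller than some w
    in C of the same block (C with w exchanged for z is then an earlier
    generator); see [exchange_out] and [exchange_in].

    Adjoining one generator at a time, the mapping cone [linear_res_cone] extends
    a resolution of the ideal of the earlier generators by a resolution of
    S/(T(C)), shifted by the degree q + r of x_C.  The latter has Koszul ranks, so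
    after the last generator there is a resolution in which homological degree i
    has sum_C 'C(#|T(C)|, i) generators, all of degree q + r + i
    ([linear_quotients]).  Its differentials consist of linear forms; hence it is
    minimal, and by the uniqueness of minimal graded resolutions
    ([minimal_ranks], [betti_linear_res]) it computes the Betti numbers: two
    comparison maps between minimal resolutions are inverse to each other up to a
    homotopy that vanishes modulo the variables.

    It remains to evaluate the sum over C.  As T(C) is the union of its parts in
    the two blocks, Vandermonde's convolution reduces it to one block, where
    [sum_gaps] evaluates the sum of 'C(#|T(A)|, j) over the q-subsets A of a set
    with n elements to 'C(n, q + j) * 'C(q + j - 1, j). *)

Set Implicit Arguments.
Unset Strict Implicit.
Unset Printing Implicit Defensive.

(** * Polynomials with prescribed support *)
Section Supports.
Import GRing.Theory.
Local Open Scope ring_scope.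
Variables (K : fieldType) (N : nat).
Local Notation S := {mpoly K[N]}.
Implicit Types (P Q R : 'X_{1..N} -> Prop) (p q : S).

Definition supp_in P p := forall m, m \in msupp p -> P m.

Lemma supp_in0 P : supp_in P 0.
Proof. by move=> m; rewrite msupp0. Qed.

Lemma supp_inD P p q : supp_in P p -> supp_in P q -> supp_in P (p + q).
Proof.
by move=> hp hq m /msuppD_le; rewrite mem_cat => /orP[/hp|/hq].
Qed.

Lemma supp_inN P p : supp_in P p -> supp_in P (- p).
Proof. by move=> hp m; rewrite (perm_mem (msuppN p)) => /hp. Qed.

Lemma supp_in_sum (I : finType) P (F : I -> S) :
  (forall i, supp_in P (F i)) -> supp_in P (\sum_i F i).
Proof.
move=> hF; elim/big_ind: _ => //; [exact: supp_in0 | exact: supp_inD].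
Qed.

Lemma supp_inM P Q R p q :
  (forall m1 m2, P m1 -> Q m2 -> R (m1 + m2)%MM) ->
  supp_in P p -> supp_in Q q -> supp_in R (p * q).
Proof.
move=> hPQR hp hq m /msuppM_le /allpairsP[[m1 m2] /= [/hp h1 /hq h2 ->]].
exact: hPQR.
Qed.

Lemma supp_inS P Q p : (forall m, P m -> Q m) -> supp_in P p -> supp_in Q p.
Proof. by move=> hPQ hp m /hp/hPQ. Qed.

Lemma supp_in_contra P Q p :
  supp_in P p -> supp_in Q p -> (forall m, P m -> Q m -> False) -> p = 0.
Proof.
move=> hP hQ hPQ; apply: msuppnil0; case E: (msupp p) => [//|m s].
have hm : m \in msupp p by rewrite E mem_head.
by case: (hPQ m (hP m hm) (hQ m hm)).
Qed.

Lemma supp_inX P m : P m -> supp_in P 'X_[m].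
Proof. by move=> hm m'; rewrite msuppX inE => /eqP->. Qed.

(** Splits off the terms selected by [b]: taking a homogeneous component, or
    reducing a polynomial modulo a monomial ideal, are both of this kind. *)
Lemma supp_in_part (b : pred 'X_{1..N}) p :
  exists2 p', supp_in b p' & supp_in (fun m => ~~ b m) (p - p').
Proof.
have hZ (c : K) m (P : 'X_{1..N} -> Prop) : P m -> supp_in P (c *: 'X_[m]).
  by move=> hm m' /msuppZ_le; apply: supp_inX.
exists (\sum_(m <- msupp p | b m) p@_m *: 'X_[m]).
  elim/big_rec: _ => [|m x hm hx]; first exact: supp_in0.
  by apply: supp_inD => //; apply: hZ.
rewrite {1}[p]mpolyE (bigID b) /=. rewrite addrAC subrr add0r.
elim/big_rec: _ => [|m x hm hx]; first exact: supp_in0.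
by apply: supp_inD => //; apply: hZ.
Qed.

(** [1 |-> p] is a degree-0 map S(-s) -> S(-t).  Writing the condition
    additively avoids the truncated difference [s - t], and makes the case
    [s < t] automatic, since then no monomial qualifies. *)
Definition degrees s t p := supp_in (fun m => mdeg m + t = s)%N p.

Lemma degreesM s t u p q :
  degrees s t p -> degrees t u q -> degrees s u (p * q).
Proof.
by apply: supp_inM => m1 m2 /= h1 h2; rewrite mdegD -addnA h2 h1.
Qed.

Lemma degree0_entryP s t p : degree0_entry s t p <-> degrees s t p.
Proof.
rewrite /degree0_entry; case: leqP => [ts|st]; split.
- by move/dhomogP=> h m /h /= ->; rewrite subnK.
- by move=> h; apply/dhomogP => m /h <-; rewrite addnK.
- by move/eqP->; apply: supp_in0.
- move=> h; apply/eqP/(supp_in_contra h h) => m hm _.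
  by move: st; rewrite -hm ltnNge leq_addl.
Qed.

Definition gradedmx f g (s : 'I_f -> nat) (t : 'I_g -> nat) (A : 'M[S]_(f, g)) :=
  forall a b, degrees (s a) (t b) (A a b).

Lemma gradedmxM f g h s t u (A : 'M_(f, g)) (B : 'M_(g, h)) :
  gradedmx s t A -> gradedmx t u B -> gradedmx s u (A *m B).
Proof.
move=> hA hB a c; rewrite mxE; apply: supp_in_sum => b.
exact: degreesM (hA a b) (hB b c).
Qed.

(** A degree-0 map that factors through a degree-0 map does so by a degree-0
    factor: keep in each entry of [W0] the terms of the expected degree.  What
    is discarded contributes to [A] only in degrees where [A] vanishes. *)
Lemma graded_factor f g h s t u (A : 'M_(f, h)) (D : 'M_(g, h)) W0 :
  gradedmx s u A -> gradedmx t u D -> A = W0 *m D ->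
  exists2 W, gradedmx s t W & A = W *m D.
Proof.
move=> hA hD AE.
have [|W hW] := @fin_all_exists ('I_f * 'I_g)%type (fun=> S) (fun ab p =>
    supp_in (fun m => mdeg m + t ab.2 == s ab.1)%N p /\
    supp_in (fun m => mdeg m + t ab.2 != s ab.1)%N (W0 ab.1 ab.2 - p)).
  move=> ab; have [p hp hp'] :=
    supp_in_part (fun m => mdeg m + t ab.2 == s ab.1)%N (W0 ab.1 ab.2).
  by exists p.
have gW : gradedmx s t (\matrix_(a, b) W (a, b)).
  move=> a b; rewrite mxE; have [hWab _] := hW (a, b).
  by apply: supp_inS hWab => m /= /eqP.
exists (\matrix_(a, b) W (a, b)) => //.
apply/eqP; rewrite -subr_eq0; apply/eqP/matrixP => a c; rewrite [RHS]mxE.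
have h1 : degrees (s a) (u c) ((A - (\matrix_(a, b) W (a, b)) *m D) a c).
  rewrite mxE; apply: supp_inD; first exact: hA.
  by rewrite mxE; apply: supp_inN; apply: gradedmxM gW hD a c.
apply: (@supp_in_contra _ (fun m => mdeg m + u c <> s a)%N _ h1) => //.
rewrite AE -mulmxBl mxE; apply: supp_in_sum => b.
apply: supp_inM (hD b c); last first.
  by rewrite !mxE; have [_] := hW (a, b); apply.
by move=> m1 m2 /= /eqP h12 h2; rewrite mdegD -addnA h2.
Qed.

End Supports.

(** * Comparison of complexes and uniqueness of minimal ranks *)
Section Comparison.
Import GRing.Theory.
Local Open Scope ring_scope.
Variables (K : fieldType) (N : nat).
Local Notation S := {mpoly K[N]}.

Lemma dependent_choice (T : nat -> Type) (P : forall i, T i -> Prop)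
    (R : forall i, T i -> T i.+1 -> Prop) (x0 : T 0%N) :
  P 0%N x0 -> (forall i x, P i x -> exists y, P i.+1 y /\ R i x y) ->
  exists f : forall i, T i,
    [/\ f 0%N = x0, forall i, P i (f i) & forall i, R i (f i) (f i.+1)].
Proof.
move=> h0 hS.
pose step i (x : {x | P i x}) : {y | P i.+1 y /\ R i (sval x) y} :=
  constructive_indefinite_description _ (hS i (sval x) (svalP x)).
pose F := fix F i : {x | P i x} :=
  if i is i'.+1 then
    let y := step i' (F i') in exist (P i'.+1) (sval y) (proj1 (svalP y))
  else exist (P 0%N) x0 h0.
exists (fun i => sval (F i)); split=> // i; first exact: svalP.
exact: (proj2 (svalP (step i (F i)))).
Qed.

Lemma lift_rows k f g h (A : 'M[S]_(k, g)) (B : 'M_(g, h)) (D : 'M_(f, g)) :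
  (forall v : 'rV_g, v *m B = 0 -> exists w, v = w *m D) ->
  A *m B = 0 -> exists W, A = W *m D.
Proof.
move=> hex AB0.
have [|W hW] := @fin_all_exists 'I_k (fun=> 'rV[S]_f) (fun a w => row a A = w *m D).
  by move=> a; apply: hex; rewrite -row_mul AB0 row0.
exists (\matrix_a W a); apply/row_matrixP => a.
by rewrite row_mul rowK.
Qed.

(** Exactness everywhere except at position 0, where the image of [d 0] is the
    submodule being resolved. *)
Definition exact_seq (b : nat -> nat) (d : forall i, 'M[S]_(b i.+1, b i)) :=
  forall i (v : 'rV_(b i.+1)), v *m d i = 0 <-> exists w, v = w *m d i.+1.

Lemma exact_seq_dd b d : @exact_seq b d -> forall i, d i.+1 *m d i = 0.
Proof.
move=> ex i; apply/row_matrixP => a; rewrite row_mul row0.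
by apply/ex; exists (delta_mx 0 a); rewrite rowE.
Qed.

(** The fundamental lemma of homological algebra, with degrees: a map of the
    position-0 modules that respects the images lifts to a chain map, since the
    source is free and the target is exact.  Both the mapping cone and the
    uniqueness of ranks rest on it. *)
Lemma comparison b c (d : forall i, 'M[S]_(b i.+1, b i))
    (e : forall i, 'M[S]_(c i.+1, c i)) s t (phi0 : 'M_(b 0%N, c 0%N)) :
  (forall i, d i.+1 *m d i = 0) -> exact_seq e ->
  (forall i, gradedmx (s i.+1) (s i) (d i)) ->
  (forall i, gradedmx (t i.+1) (t i) (e i)) ->
  gradedmx (s 0%N) (t 0%N) phi0 ->
  (exists W, d 0%N *m phi0 = W *m e 0%N) ->
  exists phi : forall i, 'M[S]_(b i, c i),
    [/\ phi 0%N = phi0, forall i, gradedmx (s i) (t i) (phi i)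
      & forall i, d i *m phi i = phi i.+1 *m e i].
Proof.
move=> dd exe gd ge g0 lift0.
have [|i phi [gphi [W hW]]|phi [phi0E Pphi Rphi]] :=
  @dependent_choice (fun i => 'M[S]_(b i, c i))
   (fun i phi => gradedmx (s i) (t i) phi /\ exists W, d i *m phi = W *m e i)
   (fun i phi psi => d i *m phi = psi *m e i) phi0.
- by split.
- have gdphi := gradedmxM (gd i) gphi.
  have [W' gW' hW'] := graded_factor gdphi (ge i) hW.
  exists W'; split=> //; split=> //.
  apply: lift_rows (e i) _ _ _; first by move=> v /exe.
  by rewrite -mulmxA -hW' mulmxA dd mul0mx.
by exists phi; split=> // i; have [] := Pphi i.
Qed.

(* Reduction modulo the irrelevant ideal. *)
Local Notation ct := (map_mx (@mcoeff N K 0%MM)).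

(** A chain endomorphism [th] with [th 0 = 0] is nullhomotopic,
    [th i.+1 = d i *m h i + h i.+1 *m d i.+1] with [h 0 = 0], and by minimality
    both terms vanish modulo the irrelevant ideal.  The homotopy is built one
    step at a time, carrying exactly what the next step needs. *)
Lemma nullhomotopic_minimal b (d : forall i, 'M[S]_(b i.+1, b i))
    (th : forall i, 'M[S]_(b i, b i)) :
  exact_seq d -> (forall i, ct (d i.+1) = 0) -> th 0%N = 0 ->
  (forall i, d i *m th i = th i.+1 *m d i) -> forall i, ct (th i) = 0.
Proof.
move=> ex mind th0 comm.
have dd := exact_seq_dd ex.
have key i : ct (th i.+1) = 0 /\ exists h : 'M[S]_(b i, b i.+1),
    (th i.+1 - d i *m h) *m d i = 0 /\ ct (d i *m h) = 0.
  elim: i => [|i [_ [h [hd hm]]]].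
    have h1 : th 1%N *m d 0%N = 0 by rewrite -comm th0 mulmx0.
    split.
      have [W ->] := lift_rows (fun v => proj1 (ex 0%N v)) h1.
      by rewrite map_mxM mind mulmx0.
    by exists 0; rewrite mulmx0 subr0 h1 map_mx0.
  have [W hW] := lift_rows (fun v => proj1 (ex i v)) hd.
  have hd' : (th i.+2 - d i.+1 *m W) *m d i.+1 = 0.
    by rewrite mulmxBl -comm -mulmxA -hW mulmxBr mulmxA dd mul0mx subr0 subrr.
  have hm' : ct (d i.+1 *m W) = 0 by rewrite map_mxM mind mul0mx.
  split; last by exists W.
  have [V hV] := lift_rows (fun v => proj1 (ex i.+1 v)) hd'.
  by rewrite -[th _](subrK (d i.+1 *m W)) hV map_mxD hm' map_mxM mind mulmx0 addr0.
by case=> [|i]; [rewrite th0 map_mx0 | case: (key i)].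
Qed.

(** [phi i *m psi i - 1] starts with 0, so it vanishes modulo the irrelevant
    ideal. *)
Lemma chain_inverse_minimal b c (d : forall i, 'M[S]_(b i.+1, b i))
    (e : forall i, 'M[S]_(c i.+1, c i))
    (phi : forall i, 'M_(b i, c i)) (psi : forall i, 'M_(c i, b i)) :
  exact_seq d -> (forall i, ct (d i.+1) = 0) ->
  (forall i, d i *m phi i = phi i.+1 *m e i) ->
  (forall i, e i *m psi i = psi i.+1 *m d i) ->
  phi 0%N *m psi 0%N = 1%:M ->
  forall i, ct (phi i) *m ct (psi i) = 1%:M.
Proof.
move=> ex mind cphi cpsi E0 i.
apply/eqP; rewrite -subr_eq0 -map_mxM -(map_mx1 (@mcoeff N K 0%MM)) -map_mxB.
apply/eqP.
apply: (@nullhomotopic_minimal b d (fun i => phi i *m psi i - 1%:M)) => //.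
  by rewrite E0 subrr.
move=> j; rewrite mulmxBr mulmxBl mulmx1 mul1mx -mulmxA -cpsi mulmxA cphi.
by rewrite mulmxA.
Qed.

(** The reductions of the two comparison maps are inverse matrices over the
    field, hence square; an invertible matrix has no zero row, and a nonzero
    constant entry of a degree-0 map joins two generators of equal degree. *)
Lemma minimal_ranks b c (d : forall i, 'M[S]_(b i.+1, b i))
    (e : forall i, 'M[S]_(c i.+1, c i)) s t (phi0 : 'M_(b 0%N, c 0%N)) psi0 :
  exact_seq d -> exact_seq e ->
  (forall i, gradedmx (s i.+1) (s i) (d i)) ->
  (forall i, gradedmx (t i.+1) (t i) (e i)) ->
  (forall i, ct (d i.+1) = 0) -> (forall i, ct (e i.+1) = 0) ->
  gradedmx (s 0%N) (t 0%N) phi0 -> gradedmx (t 0%N) (s 0%N) psi0 ->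
  phi0 *m psi0 = 1%:M -> psi0 *m phi0 = 1%:M ->
  (exists W, d 0%N *m phi0 = W *m e 0%N) ->
  (exists W, e 0%N *m psi0 = W *m d 0%N) ->
  forall i, b i = c i /\ forall a, exists a', s i a = t i a'.
Proof.
move=> exd exe gd ge md me g1 g2 E12 E21 l1 l2.
have [phi [phi0E gphi cphi]] := comparison (exact_seq_dd exd) exe gd ge g1 l1.
have [psi [psi0E gpsi cpsi]] := comparison (exact_seq_dd exe) exd ge gd g2 l2.
have E1 : forall i, ct (phi i) *m ct (psi i) = 1%:M.
  by apply: (chain_inverse_minimal exd md cphi cpsi); rewrite phi0E psi0E.
have E2 : forall i, ct (psi i) *m ct (phi i) = 1%:M.
  by apply: (chain_inverse_minimal exe me cpsi cphi); rewrite phi0E psi0E.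
move=> i; split.
  by apply/eqP; rewrite eqn_leq (mulmx1_min (E1 i)) (mulmx1_min (E2 i)).
move=> a; have := congr1 (fun M : 'M_(b i) => M a a) (E1 i).
rewrite !mxE eqxx => sum1.
have [a' _ ha'] : exists2 a', true & ct (phi i) a a' != 0.
  apply/exists_inP; apply: contraT; rewrite negb_exists_in => /forall_inP h0.
  move: sum1; rewrite big1 ?mulr1n => [/esym/eqP|j _]; first by rewrite oner_eq0.
  by have := h0 j isT; rewrite negbK => /eqP ->; rewrite mul0r.
exists a'; move: ha'; rewrite mxE -mcoeff_msupp => /(gphi i a a').
by rewrite mdeg0 add0n.
Qed.

End Comparison.

(** * Linear resolutions and mapping cones *)
Section LinearResolutions.
Import GRing.Theory.
Local Open Scope ring_scope.
Variables (K : fieldType) (N : nat).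
Local Notation S := {mpoly K[N]}.
Implicit Types (I J P : S -> Prop) (p u : S) (b c : nat -> nat).

(** Ranks of the resolution of S/I when [b] lists those of the resolution of I.
    Counting the augmentation as the differential out of position 1 makes it an
    ordinary case in all that follows. *)
Definition aug b i := if i is j.+1 then b j else 1%N.

Definition lin_shift d i := if i is j.+1 then (d + j)%N else 0%N.

(** I has a resolution with ranks [b] whose generators in homological degree i
    all have degree [d + i]; the matrices of positive index then consist of
    linear forms, so that the resolution is minimal. *)
Definition linear_res I d b :=
  exists delta : forall i, 'M[S]_(aug b i.+1, aug b i),
  [/\ forall p, I p <-> exists v, v *m delta 0%N = p%:M,
      exact_seq delta
    & forall i, gradedmx (fun=> lin_shift d i.+1) (fun=> lin_shift d i) (delta i)].

Lemma linear_res_ext I J d b c :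
  (forall p, I p <-> J p) -> b =1 c -> linear_res I d b -> linear_res J d c.
Proof.
move=> IJ /functional_extensionality <- [delta [im ex gr]].
by exists delta; split=> // p; rewrite -IJ.
Qed.

Lemma linear_res0 d : linear_res (fun p => p = 0) d (fun=> 0%N).
Proof.
have v0 (v : 'rV[S]_0) : v = 0 by apply/rowP; case.
exists (fun=> 0); split.
- move=> p; split=> [->|[v /matrixP/(_ 0 0)]].
    by exists 0; rewrite mulmx0 raddf0.
  by rewrite mulmx0 !mxE eqxx mulr1n => <-.
- by move=> i v; split=> _; [exists 0; rewrite mul0mx (v0 v) | rewrite mulmx0].
- by move=> i a b; rewrite mxE; apply: supp_in0.
Qed.

(** The mapping cone of multiplication by u.  If P = (I : u), the sequence
    0 -> S/P(-d) -> S/I -> S/(I + (u)) -> 0 is exact with first map u; lifting u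
    to a chain map [phi] between the resolutions of S/P and S/I, its cone
    resolves S/(I + (u)).  As deg u = d, the shifted resolution of S/P has
    generators in degrees d, d+1, d+2, and so on, as a linear resolution of
    I + (u) requires. *)
Lemma linear_res_cone I J P d u b c :
  linear_res I d b -> linear_res P 1 c -> degrees d 0 u ->
  (forall a, I (a * u) <-> P a) ->
  (forall p, J p <-> exists f a, I f /\ p = f + a * u) ->
  linear_res J d (fun i => b i + aug c i)%N.
Proof.
move=> [dF [imF exF gF]] [dG [imG exG gG]] du colon JE.
have gG' i : gradedmx (fun=> d + i.+1)%N (fun=> d + i)%N (dG i).
  move=> a e; apply: supp_inS (gG i a e) => m.
  by case: (i) => [|j] /= h; rewrite addnC -addnA [X in (d + X)%N]addnC h.
have := @comparison K N (aug c) (aug b) dG dF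
  (fun i _ => (d + i)%N) (fun i _ => lin_shift d i) u%:M (exact_seq_dd exG) exF.
case=> [i|i|||phi [phi0E gphi cphi]]; last first.
- pose D i : 'M[S]_(aug (fun i => b i + aug c i)%N i.+1,
                    aug (fun i => b i + aug c i)%N i) :=
    match i with
    | 0%N => col_mx (dF 0%N) u%:M
    | i'.+1 => block_mx (dF i'.+1) 0 (phi i'.+1) (- dG i')
    end.
  have ddF := exact_seq_dd exF; have ddG := exact_seq_dd exG.
  exists D; split.
  + move=> p; rewrite JE; split=> [[f [a [/imF[v hv] ->]]]|[v]].
      exists (row_mx v a%:M); rewrite mul_row_col hv mul_scalar_mx.
      by rewrite scale_scalar_mx raddfD.
    rewrite -[v]hsubmxK mul_row_col [rsubmx v]mx11_scalar mul_scalar_mx.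
    rewrite scale_scalar_mx => vD.
    exists (p - rsubmx v 0 0 * u), (rsubmx v 0 0); split; last by rewrite subrK.
    apply/imF; exists (lsubmx v); rewrite raddfB; apply/eqP.
    by rewrite eq_sym subr_eq; apply/eqP/esym/vD.
    (* A cycle (v1, v2) of the cone: v2 is a boundary w2 dG, and correcting v1
       by w2 phi gives a cycle of the resolution of S/I. *)
  + have step i (v1 : 'rV_(aug b i.+1)) (v2 : 'rV_(aug c i)) w2 :
      v2 = w2 *m dG i -> v1 *m dF i + v2 *m phi i = 0 ->
      exists w1, v1 = w1 *m dF i.+1 - w2 *m phi i.+1.
      move=> v2E v1E.
      have /exF[w1 w1E] : (v1 + w2 *m phi i.+1) *m dF i = 0.
        by rewrite mulmxDl -mulmxA -cphi mulmxA -v2E.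
      by exists w1; rewrite -w1E addrK.
    have pack i (v : 'rV_(aug b i.+1 + aug c i)) w1 w2 :
      lsubmx v = w1 *m dF i.+1 - w2 *m phi i.+1 -> rsubmx v = w2 *m dG i ->
      v = row_mx w1 (- w2) *m D i.+1.
      move=> v1E v2E; rewrite -[v]hsubmxK v1E v2E mul_row_block mulmx0 add0r.
      by rewrite mulNmx mulmxN mulNmx opprK.
    case=> [|i] v; split=> [|[w ->]].
    (* At the bottom there is no dG to test v2 against: the cycle condition says
       that v2 u lies in I, that is, v2 lies in the colon ideal. *)
    * rewrite -{1}[v]hsubmxK mul_row_col => v0.
      have /imG[w2 w2E] : P (rsubmx v 0 0).
        apply/colon/imF; exists (- lsubmx v).
        rewrite mulNmx; apply/eqP; rewrite eqr_oppLR -addr_eq0 -v0.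
        rewrite [X in X *m u%:M]mx11_scalar.
        by rewrite mul_scalar_mx scale_scalar_mx.
      rewrite -mx11_scalar in w2E.
      rewrite -phi0E in v0.
      have [w1 w1E] := step 0%N _ _ _ (esym w2E) v0.
      by exists (row_mx w1 (- w2)); apply: pack.
    * rewrite -[w]hsubmxK /= mul_row_block mul_row_col -phi0E.
      rewrite mulmx0 add0r mulmxDl -mulmxA ddF mulmx0 add0r -mulmxA -cphi.
      by rewrite mulmxN mulNmx -mulmxA addrN.
    * rewrite -{1}[v]hsubmxK mul_row_block mulmx0 add0r -row_mx0.
      move=> /eq_row_mx[v1E /eqP]; rewrite mulmxN oppr_eq0 => /eqP/exG[w2 v2E].
      have [w1 w1E] := step i.+1 _ _ _ v2E v1E.
      by exists (row_mx w1 (- w2)); apply: pack.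
    * rewrite -[w]hsubmxK /= !mul_row_block !mulmx0 !add0r mulmxDl.
      rewrite -!mulmxA ddF mulmx0 add0r -cphi !(mulmxN, mulNmx) opprK.
      by rewrite addrN ddG mulmx0 row_mx0.
  + case=> [|i] a e.
      rewrite -[a]splitK; case: (split a) => a'; rewrite /= ?col_mxEu ?col_mxEd.
        exact: gF 0%N a' e.
      by rewrite !mxE !ord1 mulr1n addn0.
    rewrite -[a]splitK -[e]splitK; case: (split a) => a'; case: (split e) => e';
    rewrite /= ?block_mxEul ?block_mxEur ?block_mxEdl ?block_mxEdr.
    * exact: gF i.+1 a' e'.
    * by rewrite mxE; apply: supp_in0.
    * exact: gphi i.+1 a' e'.
    * rewrite mxE; apply: supp_inN; apply: supp_inS (gG' i a' e') => m.
      by case: (i).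
- have [|W hW] := @fin_all_exists 'I_(c 0%N) (fun=> 'rV[S]_(b 0%N))
    (fun a w => w *m dF 0%N = (dG 0%N a 0 * u)%:M).
    move=> a; apply/imF/colon/imG; exists (delta_mx 0 a).
    by rewrite -rowE [LHS]mx11_scalar mxE.
  exists (\matrix_a W a); apply/row_matrixP => a.
  rewrite !row_mul rowK hW [row a _]mx11_scalar mul_scalar_mx scale_scalar_mx.
  by rewrite mxE.
- by move=> a e; rewrite !mxE !ord1 mulr1n addn0.
- exact: gF.
- exact: gG'.
Qed.

End LinearResolutions.

(** * Square-free monomial ideals with linear quotients *)
Section SquarefreeIdeals.
Import GRing.Theory.
Local Open Scope ring_scope.
Variables (K : fieldType) (N : nat).
Local Notation S := {mpoly K[N]}.
Implicit Types (C : {set 'I_N}) (E : {set {set 'I_N}}) (p a : S).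

Definition covers C (m : 'X_{1..N}) := [forall z in C, 0 < m z]%N.

Definition sqf_mnm C : 'X_{1..N} := [multinom (z \in C : nat) | z < N].

(** The ideal generated by the square-free monomials of the members of E: a
    polynomial lies in a monomial ideal exactly when each of its monomials is a
    multiple of a generator.  Taken as the definition, this turns colon ideals
    and inclusions into statements about sets. *)
Definition sqf_ideal E : S -> Prop :=
  supp_in (fun m => exists2 C, C \in E & covers C m).

Lemma coversE C m : covers C m = (sqf_mnm C <= m)%MM.
Proof.
apply/forall_inP/mnm_lepP => [h z|h z zC]; have := h z; rewrite mnmE.
  by case: (z \in C) => //; apply.
by rewrite zC.
Qed.

Lemma mdeg_sqf_mnm C : mdeg (sqf_mnm C) = #|C|.
Proof.
rewrite mdegE -sum1_card [RHS]big_mkcond; apply: eq_bigr => z _.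
by rewrite mnmE; case: (z \in C).
Qed.

Lemma covers_sqf_mnmD C C' m :
  covers C' (m + sqf_mnm C)%MM = covers (C' :\: C) m.
Proof.
apply/forall_inP/forall_inP => h z.
  by rewrite inE => /andP[/negPf zC /h]; rewrite mnmDE mnmE zC addn0.
move=> zC'; rewrite mnmDE mnmE; case zC: (z \in C); first by rewrite addn1.
by rewrite addn0 h // inE zC.
Qed.

Lemma supp_covers_dvd C p :
  supp_in (covers C) p -> exists a, p = a * 'X_[sqf_mnm C].
Proof.
move=> hp; exists (\sum_(m <- msupp p) p@_m *: 'X_[m - sqf_mnm C]).
rewrite mulr_suml {1}[p]mpolyE; apply: eq_big_seq => m /hp.
by rewrite coversE => le; rewrite -scalerAl -mpolyXD submK.
Qed.

Lemma sqf_idealS E E' p :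
  (forall C, C \in E -> exists2 C', C' \in E' & C' \subset C) ->
  sqf_ideal E p -> sqf_ideal E' p.
Proof.
move=> hEE'; apply: supp_inS => m [C /hEE'[C' C'E' sub] /forall_inP cov].
by exists C' => //; apply/forall_inP => z /(subsetP sub)/cov.
Qed.

Lemma sqf_idealM E a p : sqf_ideal E p -> sqf_ideal E (a * p).
Proof.
have h0 : supp_in (fun=> True) a by [].
move=> hp; apply: supp_inM h0 hp => m1 m2 _ [C CE /forall_inP cov].
exists C => //; apply/forall_inP => z /cov.
by rewrite mnmDE => lt; rewrite addn_gt0 lt orbT.
Qed.

Lemma sqf_ideal_gen E C : C \in E -> sqf_ideal E 'X_[sqf_mnm C].
Proof. by move=> CE; apply: supp_inX; exists C => //; rewrite coversE lepm_refl. Qed.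

Lemma sqf_idealU1 C E p :
  sqf_ideal (C |: E) p <->
  exists f a, sqf_ideal E f /\ p = f + a * 'X_[sqf_mnm C].
Proof.
split=> [hp|[f [a [hf ->]]]]; last first.
  apply: supp_inD.
    by apply: sqf_idealS hf => C' C'E; exists C' => //; rewrite inE C'E orbT.
  by apply/sqf_idealM/sqf_ideal_gen; rewrite !inE eqxx.
have [f hf hpf] := supp_in_part (fun m => [exists C' in E, covers C' m]) p.
have [|a aE] := @supp_covers_dvd C (p - f).
  move=> m mpf; have := hpf m mpf.
  have /msuppB_le := mpf; rewrite mem_cat => /orP[/hp|/hf -> //] [C'].
  rewrite !inE => /orP[/eqP-> //|C'E] cov /negP[].
  by apply/exists_inP; exists C'.
exists f, a; rewrite -aE addrC subrK; split=> //.
by apply: supp_inS hf => m /exists_inP[C' C'E cov]; exists C'.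
Qed.

(** x_C' divides x^m x_C exactly when x_(C' minus C) divides x^m. *)
Lemma sqf_ideal_colon C E a :
  sqf_ideal E (a * 'X_[sqf_mnm C]) <-> sqf_ideal [set C' :\: C | C' in E] a.
Proof.
split=> h m hm.
  have [|C' C'E] := h (m + sqf_mnm C)%MM.
    by rewrite addmC mcoeff_msupp mcoeffMX -mcoeff_msupp.
  by rewrite covers_sqf_mnmD; exists (C' :\: C) => //; apply: imset_f.
move: hm; rewrite (perm_mem (msuppMX _ _)) => /mapP[m' /h[_ /imsetP[C' C'E ->]]].
by rewrite -covers_sqf_mnmD => cov ->; exists C'; rewrite // addmC.
Qed.

(** The square-free ideal of [points T] is generated by the variables in T. *)
Definition points (T : {set 'I_N}) : {set {set 'I_N}} := [set [set z] | z in T].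

(** The last two hypotheses say that the colon ideal (E : x_C), generated by the
    x_(C' minus C), is generated by the variables in T. *)
Lemma linear_quotient_step E C (T : {set 'I_N}) d b c :
  linear_res (sqf_ideal E) d b -> linear_res (sqf_ideal (points T)) 1 c ->
  #|C| = d ->
  (forall C', C' \in E -> exists2 z, z \in T & z \in C' :\: C) ->
  (forall z, z \in T -> exists2 C', C' \in E & C' :\: C \subset [set z]) ->
  linear_res (sqf_ideal (C |: E)) d (fun i => b i + aug c i)%N.
Proof.
move=> resE resT cardC hE hT.
apply: (linear_res_cone (u := 'X_[sqf_mnm C]) resE resT).
- by apply: supp_inX; rewrite mdeg_sqf_mnm addn0.
- move=> a; rewrite sqf_ideal_colon; split; apply: sqf_idealS.
    move=> _ /imsetP[C' /hE[z zT zC'] ->]; exists [set z]; last by rewrite sub1set.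
    exact: imset_f.
  move=> _ /imsetP[z /hT[C' C'E sub] ->]; exists (C' :\: C) => //.
  exact: imset_f.
- exact: sqf_idealU1.
Qed.

Lemma sqf_ideal_set0 p : sqf_ideal set0 p <-> p = 0.
Proof.
split=> [hp|->]; last exact: supp_in0.
by apply: (supp_in_contra hp hp) => m [C]; rewrite inE.
Qed.

(** The Koszul ranks, obtained by adjoining the variables one at a time: the
    colon ideal of variables by a new variable is the same ideal, so that the
    cone step uses the induction hypothesis twice and adds up to Pascal's
    rule. *)
Lemma linear_res_points T :
  linear_res (sqf_ideal (points T)) 1 (fun i => 'C(#|T|, i.+1)).
Proof.
have [k] := ubnP #|T|; elim: k T => // k IHk T.
have [->|[z zT]] := set_0Vmem T.
  move=> _; rewrite cards0.
  apply: linear_res_ext (linear_res0 K N 1) => // p.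
  by rewrite -sqf_ideal_set0 /points imset0.
rewrite (cardsD1 z) zT ltnS add1n => /IHk IH.
have zTE C' : C' \in points (T :\ z) -> exists2 t, t \in T :\ z & t \in C' :\: [set z].
  case/imsetP=> t; rewrite !inE => /andP[tz tT] ->; exists t; rewrite !inE ?tz //.
  by rewrite eqxx.
have := linear_quotient_step IH IH (cards1 z) zTE.
have -> : points T = [set z] |: points (T :\ z).
  by rewrite -{1}(setD1K zT) /points imsetU1.
move=> H.
apply: linear_res_ext (H _) => //.
  by case=> [|i]; rewrite [RHS]binS //= bin0.
by move=> t tT; exists [set t]; [exact: imset_f | exact: subsetDl].
Qed.

(** Generators are adjoined in increasing order of [wt]; each x_C contributes a
    copy of the Koszul complex on the variables in T C. *)
Lemma linear_quotients (F : {set {set 'I_N}}) (T : {set 'I_N} -> {set 'I_N})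
    (wt : {set 'I_N} -> nat) d :
  injective wt ->
  (forall C, C \in F -> #|C| = d) ->
  (forall C C', C \in F -> C' \in F -> (wt C' < wt C)%N ->
     exists2 z, z \in T C & z \in C' :\: C) ->
  (forall C z, C \in F -> z \in T C ->
     exists C', [/\ C' \in F, (wt C' < wt C)%N & C' :\: C \subset [set z]]) ->
  linear_res (sqf_ideal F) d (fun i => \sum_(C in F) 'C(#|T C|, i))%N.
Proof.
move=> wt_inj cardF hF hT.
pose Fk k := [set C in F | wt C < k]%N.
have key k : linear_res (sqf_ideal (Fk k)) d
                 (fun i => \sum_(C in Fk k) 'C(#|T C|, i))%N.
  elim: k => [|k IHk].
    have F0 : Fk 0%N = set0 by apply/setP => C; rewrite !inE ltn0 andbF.
    rewrite F0; apply: linear_res_ext (linear_res0 K N d) => [p|i].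
      by rewrite sqf_ideal_set0.
    by rewrite big_set0.
  have [/existsP[C /andP[CF /eqP wtC]]|/existsPn nk] :=
    boolP [exists C, (C \in F) && (wt C == k)]; last first.
    suff -> : Fk k.+1 = Fk k by [].
    apply/setP => C; rewrite !inE ltnS leq_eqVlt andb_orr.
    by rewrite (negPf (nk C)).
  have FkS : Fk k.+1 = C |: Fk k.
    apply/setP => C'; rewrite !inE ltnS leq_eqVlt andb_orr -wtC (inj_eq wt_inj).
    by congr (_ || _); case: eqP => [->|]; rewrite ?CF ?andbF.
  rewrite FkS.
  have CFk : C \notin Fk k by rewrite inE wtC ltnn andbF.
  apply: linear_res_ext
    (linear_quotient_step IHk (linear_res_points (T C)) (cardF C CF) _ _) => //.
  - move=> i; rewrite big_setU1 //= addnC; congr (_ + _)%N.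
    by case: i => [|i] //=; rewrite bin0.
  - by move=> C'; rewrite inE -wtC => /andP[C'F lt]; apply: hF.
  - move=> z /(hT C z CF)[C' [C'F lt sub]]; exists C' => //.
    by rewrite inE C'F -wtC.
suff -> : F = Fk (\max_(C in F) wt C).+1 by [].
apply/setP => C; rewrite inE; case CF: (C \in F) => //=.
by rewrite ltnS (leq_bigmax_cond _ CF).
Qed.

End SquarefreeIdeals.

(** * Sets with prescribed numbers of elements in each block *)
Section BlockSets.
Variables (N : nat).
Implicit Types (A B C D X : {set 'I_N}).

(** Numbers the sets in colexicographic order: comparing two values compares
    the sets at the largest element where they differ. *)
Definition colex C := \sum_(z in C) 2 ^ z.

Lemma colex_lt C C' (w : 'I_N) : w \in C -> w \notin C' ->
  (forall z : 'I_N, w < z -> (z \in C) = (z \in C')) -> colex C' < colex C.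
Proof.
move=> wC wC' same; rewrite /colex.
rewrite (bigID (fun z : 'I_N => w < z)) [X in _ < X](bigID (fun z : 'I_N => w < z)) /=.
have -> : \sum_(z in C | w < z) 2 ^ z = \sum_(z in C' | w < z) 2 ^ z.
  by apply: eq_bigl => z; case wz: (w < z); rewrite ?andbF // same.
rewrite ltn_add2l [X in _ < X](bigD1 w) /=; last by rewrite wC ltnn.
apply: leq_trans (leq_addr _ _).
have sum2 k : \sum_(i < k) 2 ^ i < 2 ^ k.
  by rewrite -[X in _ < X]prednK ?expn_gt0 // predn_exp mul1n.
apply: leq_ltn_trans (sum2 w).
rewrite (big_ord_widen N (fun i => 2 ^ i)) ?(ltnW (ltn_ord w)) //.
rewrite [X in _ <= X]big_mkcond [X in X <= _]big_mkcond /=.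
apply: leq_sum => z _; case: ifP => // /andP[zC' zw].
rewrite ifT // ltn_neqAle leqNgt zw andbT.
by apply: contraNneq wC' => /val_inj <-.
Qed.

Lemma top_diff C C' : C != C' ->
  exists w : 'I_N, (w \in C) != (w \in C') /\
    (forall z : 'I_N, w < z -> (z \in C) = (z \in C')).
Proof.
move=> neq; have [w0 hw0] : exists w, (w \in C) != (w \in C').
  apply/existsP; apply: contraR neq; rewrite negb_exists => /forallP h.
  by apply/eqP/setP => z; have := h z; rewrite negbK => /eqP.
case: (@arg_maxnP _ w0 (fun w => (w \in C) != (w \in C')) val hw0) => w hw wmax.
exists w; split=> // z wz; apply/eqP; apply: contraLR wz => /wmax.
by rewrite -leqNgt.
Qed.

Lemma colex_inj : injective colex.
Proof.
move=> C C' eq_wt; apply/eqP/negPn/negP => /top_diff[w []].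
case wC: (w \in C); case wC': (w \in C') => // _ same.
  by have := colex_lt wC (negbT wC') same; rewrite eq_wt ltnn.
have := colex_lt wC' (negbT wC) (fun z h => esym (same z h)).
by rewrite eq_wt ltnn.
Qed.

Lemma colex_ltP C C' : colex C' < colex C ->
  exists w : 'I_N, [/\ w \in C, w \notin C' &
    forall z : 'I_N, w < z -> (z \in C) = (z \in C')].
Proof.
move=> lt; have /top_diff[w []] : C != C'.
  by apply: contraTneq lt => ->; rewrite ltnn.
case wC: (w \in C); case wC': (w \in C') => // _ same.
  by exists w; rewrite wC wC'.
have := colex_lt wC' (negbT wC) (fun z h => esym (same z h)).
by rewrite ltnNge (ltnW lt).
Qed.

Section Exchange.
Variables (J : finType) (blk : 'I_N -> J) (q : J -> nat).

Definition block (j : J) := [set z | blk z == j].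

Definition block_family := [set C | [forall j, #|C :&: block j| == q j]].

(** The elements that can enter C in exchange for a larger element of C in the
    same block; the variables generating the colon ideal at C. *)
Definition exchanges C :=
  [set z | (z \notin C) && [exists w in C, (z < w) && (blk w == blk z)]].

Lemma block_familyP C : 
  reflect (forall j, #|C :&: block j| = q j) (C \in block_family).
Proof. by rewrite inE; apply/'forall_eqP. Qed.

Lemma card_block_family C : C \in block_family -> #|C| = \sum_j q j.
Proof.
move/block_familyP=> hC; rewrite -sum1_card (partition_big blk predT) //=.
apply: eq_bigr => j _; rewrite -hC -sum1_card.
by apply: eq_bigl => z; rewrite !inE.
Qed.

(** Let w be the largest element where C and C' differ; it lies in C.  The block
    of w contains as many elements of C as of C', hence some z in C' but not in
    C, and z < w by the choice of w. *)
Lemma exchange_out C C' : C \in block_family -> C' \in block_family ->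
  colex C' < colex C -> exists2 z, z \in exchanges C & z \in C' :\: C.
Proof.
move=> /block_familyP hC /block_familyP hC' /colex_ltP[w [wC wC' same]].
have /subsetPn[z] : ~~ (C' :&: block (blk w) \subset C :&: block (blk w)).
  apply/negP => sub; have /eqP E : C' :&: block (blk w) == C :&: block (blk w).
    by rewrite eqEcard sub hC hC' /=.
  have : w \in C' :&: block (blk w) by rewrite E !inE wC eqxx.
  by rewrite inE (negPf wC').
rewrite !inE => /andP[zC' /eqP zw]; rewrite zw eqxx andbT => zC.
exists z; rewrite !inE zC ?zC' //; apply/exists_inP; exists w => //.
rewrite zw eqxx andbT ltnNge leq_eqVlt negb_or; apply/andP; split.
  by apply: contraNneq zC => /val_inj <-.
by apply: contraNN zC => /same ->.
Qed.

(** Exchanging z for the larger w keeps all block counts and lowers the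
    colexicographic rank. *)
Lemma exchange_in C z : C \in block_family -> z \in exchanges C ->
  exists C', [/\ C' \in block_family, colex C' < colex C & C' :\: C \subset [set z]].
Proof.
move=> /block_familyP hC; rewrite inE => /andP[zC /exists_inP[w wC /andP[zw /eqP bzw]]].
have zNw : z != w by apply: contraTneq zw => ->; rewrite ltnn.
exists (z |: C :\ w); split.
- apply/block_familyP => j; rewrite -hC; have [jE|jN] := eqVneq j (blk z).
    have -> : (z |: C :\ w) :&: block j = z |: ((C :&: block j) :\ w).
      apply/setP => x; rewrite !inE; have [->|_] //= := eqVneq x z.
        by rewrite jE eqxx.
      by rewrite andbA.
    rewrite cardsU1 [in RHS](cardsD1 w) !inE (negPf zC) /= !andbF wC /=.
    by rewrite jE bzw eqxx.
  congr #|pred_of_set _|; apply/setP => x; rewrite !inE.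
  have [->|_] /= := eqVneq x z; first by rewrite (negPf zC) eq_sym (negPf jN).
  have [->|_] //= := eqVneq x w.
  by rewrite bzw [_ == j]eq_sym (negPf jN) andbF.
- apply: (@colex_lt _ _ w) => //; first by rewrite !inE eqxx orbF eq_sym.
  move=> x wx; rewrite !inE.
  have -> : (x == w) = false by apply/eqP => E; rewrite E ltnn in wx.
  have -> // : (x == z) = false.
  by apply/eqP => E; rewrite E ltnNge (ltnW zw) in wx.
- apply/subsetP => x; rewrite !inE.
  by case: (x == z) => //= /andP[/negPf ->]; rewrite andbF.
Qed.

End Exchange.

Definition gaps X A := [set z in X :\: A | [exists w in A, z < w]].

Lemma trinomial_revision k p j : 'C(k, p) * 'C(k - p, j) = 'C(k, p + j) * 'C(p + j, j).
Proof.
have [le|lt] := leqP (p + j) k; last first.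
  rewrite [in RHS]bin_small // mul0n; apply/eqP; rewrite muln_eq0.
  have [pk|kp] := leqP p k; last by rewrite bin_small.
  by rewrite ['C(k - p, j)]bin_small ?orbT // ltn_subLR.
have pk : p <= k := leq_trans (leq_addr _ _) le.
have jk : j <= k - p by rewrite leq_subRL.
have jpj : j <= p + j by rewrite leq_addl.
have f0 : 0 < p`! * (j`! * (k - p - j)`!) by rewrite !muln_gt0 !fact_gt0.
apply/eqP; rewrite -(eqn_pmul2r f0); apply/eqP.
have e1 := bin_fact pk; have e2 := bin_fact jk.
have e3 := bin_fact le; have e4 := bin_fact jpj.
rewrite addnK in e4; rewrite subnDA in e3.
transitivity k`!.
  by rewrite -e1 -e2 -!mulnA; congr (_ * _); rewrite mulnCA.
by rewrite -e3 -e4 -!mulnA; congr (_ * (_ * _)); rewrite mulnCA.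
Qed.

(** Induction on X, removing its largest element e.  Sets avoiding e have the
    same gaps in X as in X minus e; for a set containing e every other element
    of X outside the set is a gap, so that these sets contribute equally, and
    the trinomial revision identity brings the total to the second term of
    Pascal's rule. *)
Lemma sum_gaps X p j :
  \sum_(A : {set 'I_N} | (A \subset X) && (#|A| == p.+1)) 'C(#|gaps X A|, j) =
  'C(#|X|, p.+1 + j) * 'C(p + j, j).
Proof.
have [k] := ubnP #|X|; elim: k X => // k IHk X.
have [->|[e0 e0X]] := set_0Vmem X.
  move=> _; rewrite big_pred0 ?cards0 ?bin0n //.
  move=> A; rewrite subset0; case: eqP => [->|//]; by rewrite cards0.
case: (@arg_maxnP _ e0 (mem X) val e0X) => e /= eX emax.
have [X' XE eX'] : exists2 X', X = e |: X' & e \notin X'.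
  by exists (X :\ e); rewrite ?setD1K // !inE eqxx.
have lte z : z \in X' -> z < e.
  move=> zX'; rewrite ltn_neqAle; apply/andP; split.
    by apply: contraNneq eX' => /val_inj <-.
  by apply: emax; rewrite XE !inE zX' orbT.
rewrite XE cardsU1 eX' ltnS add1n => /IHk IH.
rewrite (bigID (fun A => e \in A)) /= addnC.
rewrite addSn binS mulnDl -addSn -IH; congr (_ + _).
  apply: eq_big => [A|A /andP[/andP[sub cardA] eA]].
    rewrite andbAC; congr (_ && _); apply/andP/idP => [[sub eA]|sub].
      apply/subsetP => z zA; have := subsetP sub z zA; rewrite !inE.
      by case: eqP => // ze; rewrite -ze zA in eA.
    split; first exact: subset_trans sub (subsetUr _ _).
    by apply: contra eX'; apply: (subsetP sub).
  congr ('C(#|pred_of_set _|, _)); apply/setP => z; rewrite !inE.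
  have [->|//] := eqVneq z e; rewrite (negPf eX') andbF /= eA /=.
  apply/negbTE/exists_inP => -[w wA]; apply/negP; rewrite -leqNgt.
  by apply: emax; rewrite XE; apply: (subsetP sub).
rewrite -trinomial_revision -cards_draws -sum_nat_const.
rewrite (reindex_onto (fun A => e |: A) (fun A => A :\ e)) /=; last first.
  by move=> A /andP[_ eA]; rewrite setD1K.
apply: eq_big => [A|A].
  rewrite !inE eqxx /= andbT; apply/andP/andP => [[/andP[sub cardA] /eqP AE]|[sub cardA]].
    have eA : e \notin A by rewrite -AE !inE eqxx.
    split; last by move: cardA; rewrite cardsU1 eA.
    apply/subsetP => z zA; have := subsetP sub z; rewrite !inE zA orbT => /(_ isT).
    by case: eqP => // ze; rewrite -ze zA in eA.
  have eA : e \notin A by apply: contra eX'; apply: (subsetP sub).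
  by rewrite setU1K // cardsU1 eA setUS // eqSS.
case/andP=> /andP[/andP[sub cardA] _] /eqP AE; congr 'C(_, _).
have eA : e \notin A by rewrite -AE !inE eqxx.
have subA : A \subset X'.
  apply/subsetP => z zA; have := subsetP sub z; rewrite !inE zA orbT => /(_ isT).
  by case: eqP => // ze; rewrite -ze zA in eA.
have -> : gaps (e |: X') (e |: A) = X' :\: A.
  apply/setP => z; rewrite !inE; have [->|ze] := eqVneq z e.
    by rewrite (negPf eX') andbF.
  case: (z \in A) => //=; case zX': (z \in X') => //=.
  by apply/exists_inP; exists e; rewrite ?inE ?eqxx // lte.
move: cardA; rewrite cardsU1 eA eqSS => /eqP <-.
by rewrite cardsD (setIidPr subA).
Qed.

End BlockSets.

(** * Ideals as spans, and Betti numbers of linear resolutions *)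
Section BettiNumbers.
Import GRing.Theory.
Local Open Scope ring_scope.
Variables (K : fieldType) (N : nat).
Local Notation S := {mpoly K[N]}.
Implicit Types (G I J : S -> Prop) (p g a : S).

Lemma ideal_span_gen G g : G g -> ideal_span G g.
Proof.
move=> Gg; exists 1%N, (fun=> 1), (fun=> g); split=> //.
by rewrite big_ord1 mul1r.
Qed.

Lemma ideal_span0 G : ideal_span G 0.
Proof.
by exists 0%N, (fun=> 0), (fun=> 0); split; [case | rewrite big_ord0].
Qed.

Lemma ideal_spanD G p1 p2 :
  ideal_span G p1 -> ideal_span G p2 -> ideal_span G (p1 + p2).
Proof.
move=> [k1 [a1 [g1 [h1 ->]]]] [k2 [a2 [g2 [h2 ->]]]].
pose glue (f1 : 'I_k1 -> S) (f2 : 'I_k2 -> S) i :=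
  match split i with inl i1 => f1 i1 | inr i2 => f2 i2 end.
exists (k1 + k2)%N, (glue a1 a2), (glue g1 g2); split=> [i|].
  by rewrite /glue; case: (split i).
rewrite big_split_ord /glue; congr (_ + _); apply: eq_bigr => i _.
  by rewrite -[lshift _ _]/(unsplit (inl _ i)) unsplitK.
by rewrite -[rshift _ _]/(unsplit (inr _ i)) unsplitK.
Qed.

Lemma ideal_spanM G a p : ideal_span G p -> ideal_span G (a * p).
Proof.
move=> [k [b [g [h ->]]]]; exists k, (fun i => a * b i), g; split=> //.
by rewrite mulr_sumr; apply: eq_bigr => i _; rewrite mulrA.
Qed.

Lemma sqf_ideal_sub_span G (E : {set {set 'I_N}}) p :
  (forall C, C \in E -> ideal_span G 'X_[sqf_mnm C]) ->
  sqf_ideal E p -> ideal_span G p.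
Proof.
move=> hE hp; rewrite [p]mpolyE big_seq.
elim/big_rec: _ => [|m x /hp[C CE cov] hx]; first exact: ideal_span0.
apply: ideal_spanD hx; rewrite -mul_mpolyC; apply: ideal_spanM.
rewrite coversE in cov; rewrite -(submK cov) mpolyXD; apply: ideal_spanM.
exact: hE.
Qed.

Lemma sqf_ideal_sum (E : {set {set 'I_N}}) k (a g : 'I_k -> S) :
  (forall i, sqf_ideal E (g i)) -> sqf_ideal E (\sum_i a i * g i).
Proof. by move=> hg; apply: supp_in_sum => i; apply/sqf_idealM/hg. Qed.

Lemma ideal_span_sqf G (E : {set {set 'I_N}}) p :
  (forall g, G g <-> exists2 C, C \in E & g = 'X_[sqf_mnm C]) ->
  ideal_span G p <-> sqf_ideal E p.
Proof.
move=> GE; split=> [[k [a [g [hg ->]]]]|].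
  by apply: sqf_ideal_sum => i; have /GE[C CE ->] := hg i; apply: sqf_ideal_gen.
apply: sqf_ideal_sub_span => C CE; apply: ideal_span_gen.
by apply/GE; exists C.
Qed.

Lemma sqf_mnmU (A B : {set 'I_N}) :
  [disjoint A & B] -> sqf_mnm (A :|: B) = (sqf_mnm A + sqf_mnm B)%MM.
Proof.
move=> dis; apply/mnmP => z; rewrite mnmDE !mnmE inE.
by case zA: (z \in A); rewrite // (disjointFr dis zA).
Qed.

(** For generators in disjoint variables the products x_A x_B are the square-free
    monomials of the unions. *)
Lemma ideal_mul_sqf I J (E1 E2 : {set {set 'I_N}}) p :
  (forall f, I f <-> sqf_ideal E1 f) -> (forall f, J f <-> sqf_ideal E2 f) ->
  (forall A B, A \in E1 -> B \in E2 -> [disjoint A & B]) ->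
  ideal_mul I J p <-> sqf_ideal [set A :|: B | A in E1, B in E2] p.
Proof.
move=> IE JE dis; split=> [[k [a [g [hg ->]]]]|].
  apply: sqf_ideal_sum => i; have [f1 [f2 [/IE h1 /JE h2 ->]]] := hg i.
  apply: supp_inM h1 h2 => m1 m2 [A AE /forall_inP covA] [B BE /forall_inP covB].
  exists (A :|: B); first exact: imset2_f.
  apply/forall_inP => z; rewrite inE mnmDE addn_gt0.
  by case/orP=> [/covA->|/covB->]; rewrite ?orbT.
apply: sqf_ideal_sub_span => _ /imset2P[A B AE BE ->].
apply: ideal_span_gen; exists 'X_[sqf_mnm A], 'X_[sqf_mnm B]; split.
- exact/IE/sqf_ideal_gen.
- exact/JE/sqf_ideal_gen.
- by rewrite sqf_mnmU ?mpolyXD // dis.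
Qed.

Lemma mcoeff0_irrelevant p : irrelevant_ideal p -> p@_0%MM = 0.
Proof.
move=> [k [a [g [hg ->]]]]; rewrite raddf_sum big1 // => i _.
have [j ->] := hg i; rewrite /= rmorphM /= mcoeffX.
by rewrite mnm1_eq0 mulr0.
Qed.

Lemma degree1_irrelevant p : supp_in (fun m => mdeg m = 1)%N p -> irrelevant_ideal p.
Proof.
move=> hp; rewrite [p]mpolyE big_seq.
elim/big_rec: _ => [|m x /hp/eqP/mdeg1P[j /eqP->] hx]; first exact: ideal_span0.
apply: ideal_spanD hx; rewrite -mul_mpolyC; apply: ideal_spanM.
by apply: ideal_span_gen; exists j.
Qed.

(** A bounded linear resolution is a minimal graded one, so the chosen minimal
    resolution [min_res I] satisfies its specification; by uniqueness it has the
    same ranks, and all its generators are in the degrees of the linear one. *)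
Lemma betti_linear_res I d (b : nat -> nat) i :
  linear_res I d b -> (exists l, forall i, (l < i)%N -> b i = 0%N) ->
  betti I i = b i /\ graded_betti I i (d + i) = b i.
Proof.
move=> [delta [im ex gr]] bounded.
pose G := FreeComplex (fun i (_ : 'I_(b i)) => d + i)%N
  (fun i => delta i.+1) (delta 0%N).
have minG j : forall x y, irrelevant_ideal (delta j.+1 x y).
  move=> x y; apply: degree1_irrelevant; apply: supp_inS (gr j.+1 x y) => m /=.
  by rewrite addnS -add1n => /addIn.
have resG : min_graded_free_resolution I G.
  split=> //; last by split=> //; [exact: ex 0%N | move=> j; exact: ex j.+1].
  split=> [j x y|x] /=; apply/degree0_entryP; first exact: gr j.+1 x y.
  exact: gr 0%N x 0.
have := epsilon_spec (inhabits (@zero_complex K N))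
  (min_graded_free_resolution I) (ex_intro _ G resG).
rewrite -/(min_res I) /betti /graded_betti.
move: (min_res I) => F [[gF gF0] [imF exF0 exF _] minF].
pose D i : 'M[S]_(aug (frrank F) i.+1, aug (frrank F) i) :=
  if i is j.+1 then frdiff F j else fraug F.
pose s i : 'I_(aug (frrank F) i) -> nat :=
  if i is j.+1 then @frshift _ _ F j else fun=> 0%N.
have exD : exact_seq D by case=> [|j] v; [exact: exF0 | exact: exF].
have gD j : gradedmx (s j.+1) (s j) (D j).
  by case: j => [|j] x y; apply/degree0_entryP; rewrite ?[y]ord1; [exact: gF0|exact: gF].
have image f1 f2 (A : 'cV[S]_f1) (B : 'cV[S]_f2) :
  (forall p, I p <-> exists v, v *m A = p%:M) ->
  (forall p, I p <-> exists v, v *m B = p%:M) -> exists W, A *m 1%:M = W *m B.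
  move=> hA hB; have [|W hW] := @fin_all_exists 'I_f1 (fun=> 'rV[S]_f2)
    (fun x w => row x A = w *m B).
    move=> x; have /hB[w hw] : I (A x 0).
      by apply/hA; exists (delta_mx 0 x); rewrite -rowE [LHS]mx11_scalar mxE.
    by exists w; rewrite hw [LHS]mx11_scalar mxE.
  exists (\matrix_x W x); apply/row_matrixP => x.
  by rewrite mulmx1 row_mul rowK.
have [] := @minimal_ranks K N (aug (frrank F)) (aug b) D delta s
  (fun j _ => lin_shift d j) 1%:M 1%:M exD ex gD gr _ _ _ _ _ _ _ _ i.+1.
- by move=> j; apply/matrixP => x y; rewrite !mxE mcoeff0_irrelevant //; apply: minF.
- by move=> j; apply/matrixP => x y; rewrite !mxE mcoeff0_irrelevant //; apply: minG.
- by move=> x y; rewrite !ord1 mxE eqxx mulr1n -mpolyX0; apply: supp_inX; rewrite mdeg0.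
- by move=> x y; rewrite !ord1 mxE eqxx mulr1n -mpolyX0; apply: supp_inX; rewrite mdeg0.
- by rewrite mulmx1.
- by rewrite mulmx1.
- exact: image.
- exact: image.
move=> /= rankE shiftE; split=> //.
rewrite -rankE -[RHS]card_ord -cardsT; apply: eq_card => x; rewrite !inE.
by have [_ ->] := shiftE x; rewrite eqxx.
Qed.

End BettiNumbers.

(** * Two blocks: counting the exchanges *)
Section TwoBlocks.
Variables (N : nat) (X : {set 'I_N}) (q r : nat).
Implicit Types (A B C : {set 'I_N}).

Definition side z := z \in X.

Definition two_degrees (b : bool) := if b then q else r.

Definition draws k (X : {set 'I_N}) := [set A : {set 'I_N} | (A \subset X) && (#|A| == k)].

Lemma two_block_familyE :
  block_family side two_degrees =
  [set A :|: B | A in draws q X, B in draws r (~: X)].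
Proof.
have b1 : block side true = X by apply/setP => z; rewrite !inE eqb_id.
have b0 : block side false = ~: X by apply/setP => z; rewrite !inE eqbF_neg.
apply/setP => C; apply/block_familyP/imset2P => [hC|[A B]].
  exists (C :&: X) (C :&: ~: X); last by rewrite -setIUr setUCr setIT.
    by rewrite inE subsetIr -b1 hC eqxx.
  by rewrite inE subsetIr -b0 hC eqxx.
rewrite !inE => /andP[sA /eqP cA] /andP[sB /eqP cB] ->; case.
  rewrite b1 setIUl (setIidPl sA).
  suff -> : B :&: X = set0 by rewrite setU0.
  by apply/eqP; rewrite setI_eq0 disjoints_subset.
rewrite b0 setIUl (setIidPl sB).
suff -> : A :&: ~: X = set0 by rewrite set0U.
by apply/eqP; rewrite setI_eq0 disjoints_subset setCK.
Qed.

Lemma card_exchanges A B : A \subset X -> B \subset ~: X ->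
  #|exchanges side (A :|: B)| = #|gaps X A| + #|gaps (~: X) B|.
Proof.
move=> sA sB.
have hA w : w \in A -> w \in X by move/(subsetP sA).
have hB w : w \in B -> w \notin X by move/(subsetP sB); rewrite inE.
have -> : exchanges side (A :|: B) = gaps X A :|: gaps (~: X) B.
  apply/setP => z; rewrite !inE negb_or /side.
  case zX: (z \in X); rewrite /= ?andbF ?andbT ?orbF.
    have -> : z \notin B by apply: contraL zX => /hB.
    rewrite andbT; congr (_ && _); apply/exists_inP/exists_inP => -[w].
      rewrite inE => /orP[wA|/hB/negPf->]; last by rewrite andbF.
      by case/andP=> zw _; exists w.
    by move=> wA zw; exists w; rewrite ?inE ?wA // zw hA.
  have -> : z \notin A by apply: contraFN zX => /hA.
  rewrite /=; congr (_ && _); apply/exists_inP/exists_inP => -[w].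
    rewrite inE => /orP[/hA->|wB]; first by rewrite andbF.
    by case/andP=> zw _; exists w.
  by move=> wB zw; exists w; rewrite ?inE ?wB ?orbT // zw (negPf (hB w wB)).
rewrite cardsU; have -> : gaps X A :&: gaps (~: X) B = set0; last first.
  by rewrite cards0 subn0.
by apply/setP => z; rewrite !inE; case: (z \in X); rewrite ?andbF.
Qed.

(** The exchanges of A :|: B split between the blocks, and Vandermonde's
    convolution separates the sum over A from the sum over B. *)
Lemma sum_two_blocks i : 0 < q -> 0 < r ->
  \sum_(C in block_family side two_degrees) 'C(#|exchanges side C|, i) =
  \sum_(j < i.+1) 'C(#|X|, q + j) * 'C(q + j - 1, j) *
    ('C(#|~: X|, r + (i - j)) * 'C(r + (i - j) - 1, i - j)).
Proof.
have sum_draws k (Y : {set 'I_N}) j : 0 < k ->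
  \sum_(A in draws k Y) 'C(#|gaps Y A|, j) = 'C(#|Y|, k + j) * 'C(k + j - 1, j).
  case: k => // k _; rewrite addSn subn1 /= -sum_gaps.
  by apply: eq_bigl => A; rewrite inE.
move=> q0 r0; rewrite two_block_familyE curry_imset2X big_imset /=; last first.
  move=> [A B] [A' B']; rewrite !inE /=.
  move=> /andP[/andP[sA _] /andP[sB _]] /andP[/andP[sA' _] /andP[sB' _]] E.
  have meet (P Q Y : {set 'I_N}) : P \subset Y -> Q \subset ~: Y -> (P :|: Q) :&: Y = P.
    move=> sP sQ; rewrite setIUl (setIidPl sP).
    suff -> : Q :&: Y = set0 by rewrite setU0.
    by apply/eqP; rewrite setI_eq0 disjoints_subset.
  congr (_, _).
    by rewrite -(meet A B X) // E meet.
  have sAC : A \subset ~: ~: X by rewrite setCK.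
  have sAC' : A' \subset ~: ~: X by rewrite setCK.
  by rewrite -(meet B A (~: X)) // setUC E setUC meet.
transitivity (\sum_(A in draws q X) \sum_(B in draws r (~: X))
  \sum_(j < i.+1) 'C(#|gaps X A|, j) * 'C(#|gaps (~: X) B|, i - j)).
  rewrite pair_big /=; apply: eq_big => [[A B]|[A B]]; first by rewrite inE.
  rewrite !inE /= => /andP[/andP[sA _] /andP[sB _]].
  by rewrite card_exchanges // binomial.Vandermonde.
under eq_bigr do rewrite exchange_big.
rewrite exchange_big; apply: eq_bigr => j _ /=.
by rewrite -!sum_draws // big_distrlr.
Qed.

End TwoBlocks.

(** * The ideals of square-free monomials in a block of variables *)
Section VariableBlocks.
Import GRing.Theory.
Local Open Scope ring_scope.
Variables (K : fieldType) (N : nat).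

Lemma prod_varsE k (h : 'I_k -> 'I_N) (A : {set 'I_k}) : injective h ->
  \prod_(i in A) 'X_(h i) = 'X_[sqf_mnm (h @: A)] :> {mpoly K[N]}.
Proof.
move=> h_inj; have XD : {morph (fun e : 'X_{1..N} => 'X_[e] : {mpoly K[N]}) :
    e f / (e + f)%MM >-> e * f} by move=> e f; apply: mpolyXD.
rewrite -(big_morph _ XD (mpolyX0 _ _)); congr 'X_[_]; apply/mnmP => z.
rewrite mnm_sumE mnmE.
under eq_bigr do rewrite mnm1E.
case: imsetP => [[i iA ->]|nz].
  rewrite (bigD1 i) //= eqxx big1 // => j /andP[_ ji].
  by rewrite (inj_eq h_inj) (negPf ji).
apply: big1 => i iA; case: eqP => // hi.
by case: nz; exists i.
Qed.

Lemma sqf_block_ideal k (h : 'I_k -> 'I_N) l (X : {set 'I_N}) (p : {mpoly K[N]}) :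
  injective h -> X = [set h i | i : 'I_k] ->
  ideal_span (fun p => exists A : {set 'I_k},
    #|A| = l /\ p = \prod_(i in A) 'X_(h i)) p <-> sqf_ideal (draws l X) p.
Proof.
move=> h_inj XE; apply: ideal_span_sqf => g; split.
  move=> [A [cA ->]]; exists (h @: A); last exact: prod_varsE.
  rewrite inE card_imset // cA eqxx XE andbT.
  by apply/subsetP => _ /imsetP[i _ ->]; apply: imset_f.
move=> [C]; rewrite inE => /andP[sC /eqP cC] ->; exists (h @^-1: C).
have hC : h @: (h @^-1: C) = C.
  apply/setP => z; apply/imsetP/idP => [[i]|zC]; first by rewrite inE => ? ->.
  have := subsetP sC z zC; rewrite XE => /imsetP[i _ zE].
  by exists i; rewrite // inE -zE.
by rewrite prod_varsE // hC -(card_imset _ h_inj) hC.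
Qed.

End VariableBlocks.

Theorem theorem3p2 (K : fieldType) (n m q r : nat)
    (hq : (1 <= q <= n)%N) (hr : (1 <= r <= m)%N) (i : nat) :
  let IJ := ideal_mul (@sqfree_x K n m q) (@sqfree_y K n m r) in
  betti IJ i = graded_betti IJ i (q + r + i) /\
  graded_betti IJ i (q + r + i) =
    (\sum_(j < i.+1) \sum_(k < i.+1 | j + k == i)
       'C(n, q + j) * 'C(m, r + k) * 'C(q + j - 1, j) * 'C(r + k - 1, k))%N.
Proof.
move=> IJ; case/andP: hq => q0 _; case/andP: hr => r0 _.
pose X : {set 'I_(n + m)} := [set lshift m i | i : 'I_n].
pose F := block_family (side X) (two_degrees q r).
have XC : ~: X = [set rshift n j | j : 'I_m].
  apply/setP => z; rewrite inE -[z]splitK; case: (split z) => j /=.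
    rewrite [X in ~~ X]imset_f //; apply/esym/imsetP => -[k _ /eqP].
    by rewrite eq_lrshift.
  rewrite [RHS]imset_f //; apply/imsetP => -[k _ /eqP].
  by rewrite eq_rlshift.
have IJE p : sqf_ideal F p <-> IJ p.
  rewrite /F two_block_familyE; symmetry; apply: ideal_mul_sqf.
  - by move=> f; apply: sqf_block_ideal => //; apply: lshift_inj.
  - by move=> f; apply: sqf_block_ideal => //; apply: rshift_inj.
  move=> A B; rewrite !inE => /andP[sA _] /andP[sB _].
  by rewrite disjoints_subset (subset_trans sA) // -setCS setCK.
pose b i := \sum_(C in F) 'C(#|exchanges (side X) C|, i).
have res : linear_res IJ (q + r) b.
  apply: linear_res_ext IJE (frefl b) _.
  apply: (@linear_quotients K _ F (exchanges (side X)) _ _ (@colex_inj _)).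
  - by move=> C /card_block_family ->; rewrite big_bool.
  - by move=> C C'; apply: exchange_out.
  - by move=> C z; apply: exchange_in.
have [|-> ->] := betti_linear_res i res.
  exists (n + m) => j lt; rewrite /b big1 // => C _; apply: bin_small.
  by apply: leq_ltn_trans lt; rewrite -[X in _ <= X]card_ord max_card.
split=> //; rewrite /b sum_two_blocks //.
have cX : #|X| = n by rewrite card_imset ?card_ord //; apply: lshift_inj.
have cXC : #|~: X| = m by rewrite XC card_imset ?card_ord //; apply: rshift_inj.
rewrite cX cXC; apply: eq_bigr => j _.
have lt : i - j < i.+1 by rewrite ltnS leq_subr.
rewrite (big_pred1 (Ordinal lt)) /=; first by rewrite mulnACA !mulnA.
move=> k; rewrite -[RHS]/(val k == i - j) -[RHS](eqn_add2l j).
by rewrite subnKC // -ltnS.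
Qed.
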